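(* Let $\kappa$ be an infinite cardinal and $\alpha<\kappa^+$ a non-zero ordinal. Then \[\mathrm{Stc}(\mathbf A_\kappa^\alpha(\mathcal C))=\begin{cases}\aleph_0, & \text{if } \alpha \text{ is a successor ordinal},\\ \mathrm{cf}(\alpha), & \text{if } \alpha \text{ is a limit ordinal}.\end{cases}\] Consequently $\mathrm{Stc}(\mathbf A_\kappa(\mathcal C))=\kappa^+$.
   Context: All graphs are simple and undirected. An immersion of $G$ into $H$ is an injective map $\phi:V(G)\to V(H)$ with $uv\in E(G)\Rightarrow\phi(u)\phi(v)\in E(H)$; it is strong if moreover $uv\in E(G)\iff\phi(u)\phi(v)\in E(H)$. For a class $\mathcal D$, a family $\mathcal F\subseteq\mathcal D$ is strongly universal if every member of $\mathcal D$ strongly immerses into some $H\in\mathcal F$; $\mathrm{Stc}(\mathcal D)$ is the minimal cardinality of such a family. Rank: a graph has rank $0$ iff finite; for $\alpha>0$, $G$ has rank $\alpha$ iff it has no smaller rank and there is a finite subgraph $F$ such that every component of $G-F$ has rank $<\alpha$; rayless graphs (no one-way infinite path) are exactly those with a rank. A $\kappa$-rayless graph is a connected rayless graph with at most $\kappa$ vertices. $\mathcal C$ is the family of all (finite) cycles; $\mathbf A_\kappa(\mathcal C)$ is the class of $\kappa$-rayless graphs into which no cycle immerses (i.e. rayless trees with at most $\kappa$ vertices), and $\mathbf A_\kappa^\alpha(\mathcal C)$ its subclass of graphs of rank $<\alpha$. *)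

(* Defs.v *)
From mathcomp Require Import all_boot all_classical.
From mathcomp Require Import wochoice.
From Stdlib Require Import Relation_Operators.

Set Implicit Arguments.
Unset Strict Implicit.
Unset Printing Implicit Defensive.

Local Open Scope classical_set_scope.
Local Open Scope card_scope.

(** A cardinal is represented by a type of that cardinality, equality and
    inequality of cardinals by [#=] and [#<=]. *)

Definition card_lt (A B : Type) : Prop :=
  ([set: A] #<= [set: B]) /\ ~ ([set: B] #<= [set: A]).

Definition is_least_card (P : Type -> Prop) (c : Type) : Prop :=
  P c /\ forall c', P c' -> [set: c] #<= [set: c'].

(** In any nonempty family of types, one has least cardinality.  The proof takes
    a maximal set [S] of points of the product such that distinct points of [S]
    differ in every coordinate. *)
Lemma least_card_family (I : Type) (X : I -> Type) (i0 : I) :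
  exists i, forall j, [set: X i] #<= [set: X j].
Proof.
pose disj (S : set (forall i, X i)) : Prop :=
  forall s t, S s -> S t -> forall i, s i = t i -> s = t.
have [|S [Sdisj Smax]] := @Zorn_bigcup (forall i, X i) disj.
  move=> F Fdisj Ftot s t [A FA As] [B FB Bt] i.
  have [AB|BA] := Ftot A B FA FB.
    by apply: (Fdisj _ FB) => //; apply: AB.
  by apply: (Fdisj _ FA) => //; apply: BA.
have [i isurj] : exists i, forall x : X i, exists2 s, S s & s i = x.
  apply: contrapT => /forallNP nosurj.
  have {}nosurj i : exists x : X i, forall s, S s -> s i <> x.
    have /existsNP[x xP] := nosurj i.
    by exists x => s Ss sx; apply: xP; exists s.
  pose f i := sval (cid (nosurj i)).
  have fP i s : S s -> s i <> f i by exact: (svalP (cid (nosurj i))).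
  apply: (Smax (S `|` [set f])).
    split=> [s|]; first by left.
    move=> sub; have Sf : S f by apply: sub; right.
    exact: (fP i0 _ Sf).
  move=> s t [Ss|->] [St|->] j // e; first exact: (Sdisj _ _ Ss St j e).
    by case: (fP j s Ss).
  by case: (fP j t St).
exists i => j.
have gex (x : X i) : exists s, S s /\ s i = x.
  by have [s Ss sx] := isurj x; exists s.
pose g x := sval (cid (gex x)).
have gS x : S (g x) by case: (svalP (cid (gex x))).
have gK x : g x i = x by case: (svalP (cid (gex x))).
have inj : {in [set: X i] &, injective (fun x => g x j)}.
  by move=> x y _ _ e; rewrite -(gK x) -(gK y) (Sdisj _ _ (gS x) (gS y) j e).
have := inj_card_eq inj; rewrite card_eq_sym => /card_eqPle[le1 _].
exact: card_le_trans le1 (card_leT _).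
Qed.

Lemma card_le_total (A B : Type) :
  ([set: A] #<= [set: B]) \/ ([set: B] #<= [set: A]).
Proof.
have [[] le] := @least_card_family bool (fun b => if b then A else B) true.
  by left; exact: (le false).
by right; exact: (le true).
Qed.

(** The index type is made of subsets of some [c0] satisfying [P], rather than of
    all types satisfying [P], in order not to raise universes. *)
Lemma least_card_exists (P : Type -> Prop) :
  (exists c, P c) -> exists c, is_least_card P c.
Proof.
move=> [c0 Pc0].
pose I := {A : set c0 | exists c, P c /\ ([set: c] #= A)}.
have i0 : I by exists setT, c0.
have [i imin] := @least_card_family I (fun i => set_type (sval i)) i0.
case: (svalP i) => c [Pc ci]; exists c; split=> // c' Pc'.
have ic : [set: c] #<= [set: set_type (sval i)].
  by rewrite (card_le_eql ci) (card_le_eqr (card_setT _)).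
have [lec'|gec'] := card_le_total c0 c'.
  apply: card_le_trans ic _; rewrite (card_le_eql (card_setT _)).
  exact: card_le_trans (card_leT _) lec'.
have [A eA] : exists A : set c0, [set: c'] #= A.
  move: gec' => /card_leP[f]; exists (range (fun x => set_val (f (to_setT x)))).
  rewrite card_eq_sym; apply: inj_card_eq => x y _ _.
  by move=> /val_inj /inj; rewrite !inE => /(_ Logic.I Logic.I) /(congr1 val).
apply: (card_le_trans (card_le_trans ic (imin (exist _ A (ex_intro _ c' (conj Pc' eA)))))).
by rewrite (card_le_eql (card_setT _)) /= (card_le_eql (card_esym eA)).
Qed.

(** The least cardinal satisfying [P]; [void] is a junk value, taken only if no
    type satisfies [P]. *)
Definition least_card (P : Type -> Prop) : Type :=
  match pselect (exists c, P c) with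
  | left h => sval (cid (least_card_exists h))
  | right _ => void
  end.

Lemma least_cardP (P : Type -> Prop) :
  (exists c, P c) -> is_least_card P (least_card P).
Proof.
by rewrite /least_card; case: pselect => // h _; exact: (svalP (cid _)).
Qed.

Definition succ_card (K : Type) : Type := least_card (card_lt K).

(** An ordinal is represented by a well-ordered type; the elements of the type
    stand for the smaller ordinals.  An ordinal [alpha] is below a cardinal, seen
    as an initial ordinal, iff [card_lt] holds between their types. *)

Record ordinal_number := OrdinalNumber {
  ord_sort :> Type;
  ord_le : rel ord_sort;
  ord_wo : well_order ord_le }.

Definition ord_lt (alpha : ordinal_number) (a b : alpha) : Prop :=
  ~~ ord_le b a.

Lemma ord_lt_wf (alpha : ordinal_number) : well_founded (@ord_lt alpha).
Proof.
pose A : {pred alpha} := fun a => `[< ~ Acc (@ord_lt alpha) a >].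
move=> a; apply: contrapT => na.
have [|z [[/asboolP nz zmin] _]] := @ord_wo alpha A.
  by exists a; apply/asboolP.
apply: nz; constructor=> y yz; apply: contrapT => ny.
by move: yz; rewrite /ord_lt zmin//; apply/asboolP.
Qed.

Definition is_nonzero_ord (alpha : ordinal_number) : Prop :=
  exists a : alpha, True.

(** If [m] is the greatest element, then [alpha] is the successor of the ordinal
    represented by [m]. *)
Definition is_successor_ord (alpha : ordinal_number) : Prop :=
  exists m : alpha, forall a, ord_le a m.

Definition is_limit_ord (alpha : ordinal_number) : Prop :=
  is_nonzero_ord alpha /\ ~ is_successor_ord alpha.

Definition cofinal (alpha : ordinal_number) (B : set alpha) : Prop :=
  forall a, exists2 b, B b & ord_le a b.

Definition cf (alpha : ordinal_number) : Type :=
  least_card (fun c => exists B : set alpha, cofinal B /\ (B #= [set: c])).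

Record graph := Graph {
  vertex :> Type;
  adj : vertex -> vertex -> Prop;
  adj_sym : forall u v, adj u v -> adj v u;
  adj_irrefl : forall u, ~ adj u u }.

Definition immersion (G H : graph) (f : G -> H) : Prop :=
  injective f /\ forall u v, adj u v -> adj (f u) (f v).

Definition strong_immersion (G H : graph) (f : G -> H) : Prop :=
  injective f /\ forall u v, adj u v <-> adj (f u) (f v).

Definition immerses (G H : graph) : Prop :=
  exists f : G -> H, immersion f.

Definition strongly_immerses (G H : graph) : Prop :=
  exists f : G -> H, strong_immersion f.

(** [set graph] would put the types of vertices strictly below the universe
    shared by [set], [set_type] and ['I_n]. *)
Definition graph_class := graph -> Prop.

Definition strongly_universal (D F : graph_class) : Prop :=
  (forall H, F H -> D H) /\
  forall G, D G -> exists2 H, F H & strongly_immerses G H.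

(** The families of cardinality [c] are the ranges of the injections from [c]
    to [graph]. *)
Definition Stc (D : graph_class) : Type :=
  least_card (fun c => exists F : c -> graph,
    injective F /\ strongly_universal D (fun G => exists i, F i = G)).

Definition rayless (G : graph) : Prop :=
  ~ exists r : nat -> G, injective r /\ forall n, adj (r n) (r n.+1).

Definition linked (G : graph) : G -> G -> Prop := clos_refl_trans G (@adj G).

Definition connected_graph (G : graph) : Prop :=
  (exists u : G, True) /\ forall u v : G, linked u v.

Section Induced.
Variables (G : graph) (S : set G).

Definition induced_adj (u v : {x : G | S x}) : Prop := adj (sval u) (sval v).

Definition induced : graph :=
  @Graph {x : G | S x} induced_adj
    (fun u v => @adj_sym G (sval u) (sval v))
    (fun u => @adj_irrefl G (sval u)).
End Induced.

Definition delete_vertices (G : graph) (F : set G) : graph := induced (~` F).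

Definition is_component (G : graph) (C : set G) : Prop :=
  exists u, C = [set v | linked u v].

(** [has_rank a G], for [a : alpha], says that the rank of [G] is the ordinal
    represented by [a], i.e. the order type of the set of all [b] with
    [ord_lt b a]. *)

Definition has_rank_step (alpha : ordinal_number) (a : alpha)
    (rank : forall b, ord_lt b a -> graph_class) : graph_class :=
  fun G : graph =>
    ((forall b, ~ ord_lt b a) /\ finite_set [set: G]) \/
    [/\ exists b, ord_lt b a,
        ~ (exists b (ba : ord_lt b a), rank b ba G) &
        exists F : set G, finite_set F /\
          forall C : set (delete_vertices F), is_component C ->
            exists b (ba : ord_lt b a), rank b ba (induced C)].

Definition has_rank (alpha : ordinal_number) : alpha -> graph_class :=
  Fix (@ord_lt_wf alpha) (fun _ => graph_class) (@has_rank_step alpha).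

Lemma has_rankE (alpha : ordinal_number) (a : alpha) (G : graph) :
  has_rank a G <->
  ((forall b, ~ ord_lt b a) /\ finite_set [set: G]) \/
  [/\ exists b, ord_lt b a,
      ~ (exists2 b, ord_lt b a & has_rank b G) &
      exists F : set G, finite_set F /\
        forall C : set (delete_vertices F), is_component C ->
          exists2 b, ord_lt b a & has_rank b (induced C)].
Proof.
have ex2E H : (exists b (_ : ord_lt b a), has_rank b H) <->
    (exists2 b, ord_lt b a & has_rank b H).
  by split=> [[b [ba bH]]|[b ba bH]]; exists b.
rewrite {1}/has_rank Fix_eq; last first.
  move=> x f g fg; congr has_rank_step.
  by apply: functional_extensionality_dep => b; apply: funext => bx.
rewrite -/(@has_rank alpha) /has_rank_step /=.
split=> [[?|[h1 h2 [F [finF h3]]]]|[?|[h1 h2 [F [finF h3]]]]]; [by left|right|by left|right].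
  by split=> //; [move=> /ex2E|exists F; split=> // C /h3 /ex2E].
by split=> //; [move=> /ex2E|exists F; split=> // C /h3 /ex2E].
Qed.

(** The cycle of length [n + 3]; using ['I_n] as the type of vertices
    would put all types of vertices above its universe. *)
Section Cycle.
Variable n : nat.

Definition cycle_vertex : Type := {i : nat | i < n.+3}.

Definition cycle_adj (i j : cycle_vertex) : Prop :=
  sval j = (sval i).+1 %% n.+3 \/ sval i = (sval j).+1 %% n.+3.

Lemma cycle_adj_sym i j : cycle_adj i j -> cycle_adj j i.
Proof. by case; [right|left]. Qed.

Lemma cycle_adj_irrefl i : ~ cycle_adj i i.
Proof.
suff h : sval i <> (sval i).+1 %% n.+3 by case.
have := svalP i; rewrite leq_eqVlt => /orP[/eqP e|l].
  by rewrite e modnn => i0; move: e; rewrite i0.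
by rewrite modn_small// => /n_Sn.
Qed.

Definition cycle_graph : graph := Graph cycle_adj_sym cycle_adj_irrefl.
End Cycle.

Definition cycles : graph_class := fun G => exists n, G = cycle_graph n.

Definition kappa_rayless (K : Type) : graph_class := fun G =>
  [/\ connected_graph G, rayless G & [set: G] #<= [set: K]].

Definition kappa_rayless_avoiding (K : Type) (X : graph_class) : graph_class :=
  fun G => kappa_rayless K G /\ forall C, X C -> ~ immerses C G.

Definition kappa_rayless_avoiding_rank_lt (K : Type) (alpha : ordinal_number)
    (X : graph_class) : graph_class :=
  fun G => kappa_rayless_avoiding K X G /\ exists a : alpha, has_rank a G.

(* Main.v *)
(** The universal trees [utree (c, m, k)] have as vertices the finite sequences of
    letters [(c', m', k')] in which each step either lowers the rank [c'], with [K]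
    copies of each choice, or keeps the rank and lowers [m'], with [m] copies if it is
    lowered from [m].  The latter steps span a finite tree, whose removal leaves
    components of smaller rank, so [utree (c, m, k)] has rank at most [c]; since it contains
    infinitely many copies of [utree (d, 0, k')] for each [d < c], its rank is exactly
    [c].  Conversely, by induction on [c] and on the (well-founded) branches of a
    rooted rayless tree, every tree with at most [K] vertices and rank at most [c]
    strongly immerses into [utree (c, m, k)] for [m] large.  For a greatest rank [c],
    infinitely many [m] are needed, because [utree (c, m, k)] contains [m] disjoint
    copies of [utree (c, 0, k')], each of which meets every finite set witnessing
    that a graph containing them has rank [c].  Without a greatest rank, the [utree (c, 0, k)]
    with [c] in a cofinal set suffice, and the ranks of the members of a universal
    family are cofinal.  Finally, every [K]-rayless tree has rank below the regular
    cardinal [succ_card K]. *)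

Require Import Defs.
From mathcomp Require Import all_boot all_classical.
From mathcomp Require Import wochoice.
From Stdlib Require Import Relation_Operators.

Set Implicit Arguments.
Unset Strict Implicit.
Unset Printing Implicit Defensive.

Local Open Scope classical_set_scope.
Local Open Scope card_scope.

(** * Cardinal arithmetic *)

Lemma card_leTP (A B : Type) :
  [set: A] #<= [set: B] <-> exists f : A -> B, injective f.
Proof.
split=> [/card_leP[f]|[f injf]].
  exists (fun x => set_val (f (to_setT x))) => x y /val_inj /inj.
  by rewrite !inE => /(_ Logic.I Logic.I) /(congr1 val).
have : f @` [set: A] #= [set: A] by apply: inj_card_eq => x y _ _ /injf.
by rewrite card_eq_sym => /card_eqPle[h _]; exact: card_le_trans h (card_leT _).
Qed.

Lemma card_le_sig (T : Type) (A : set T) : A #= [set: {x | A x}].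
Proof.
have h : [set sval u | u in [set: {x | A x}]] #= [set: {x | A x}].
  by apply: inj_card_eq => -[x Ax] [y Ay] _ _ /= e; exact: eq_exist.
suff e : [set sval u | u in [set: {x | A x}]] = A by rewrite e in h.
by apply/seteqP; split=> [x [u _ <-]|x Ax]; [exact: (svalP u)|exists (exist _ x Ax)].
Qed.

Section Square.
Variable K : Type.

Let dom (X : set (K * K * K)) : set K := [set a | exists c, X (a, a, c)].

(** The square of [dom X], read off the diagonal, is coded injectively in [dom X]. A pair may have
    several codes, of which [p] below chooses one, but distinct pairs share none. *)
Let pairing (X : set (K * K * K)) : Prop :=
  [/\ forall a b c, X (a, b, c) -> [/\ dom X a, dom X b & dom X c],
      forall a b, dom X a -> dom X b -> exists c, X (a, b, c) &
      forall a b a' b' c, X (a, b, c) -> X (a', b', c) -> a = a' /\ b = b'].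

(** Zorn's lemma gives a maximal [Y] encoding an injection of [A * A] into [A], where
    [A := dom Y] is infinite.  If the complement of [A] were not of smaller
    cardinality, it would contain a copy of [A], to which the three new parts of the
    square of the union could be mapped injectively.  Otherwise [K] injects into [A]. *)
Lemma square_card_le : infinite_set [set: K] -> [set: K * K] #<= [set: K].
Proof.
move=> /infiniteP/card_leTP[e einj].
have [p0 p0inj] : exists p : nat * nat -> nat, injective p.
  by apply/card_leTP; have := card_nat2 => /card_eqPle[].
(* A pairing of a countable subset. Adjoined to every [X], it makes the chain condition hold for the
   empty chain too and the domain of the maximal pairing infinite. *)
pose X0 : set (K * K * K) :=
  [set t | exists i j, t = (e i, e j, e (p0 (i, j)))].
have dX0 i : dom X0 (e i) by exists (e (p0 (i, i))), i, i.
have PX0 : pairing X0.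
  split=> [a b c [i [j [-> -> ->]]]|a b|a b a' b' c].
  - by [].
  - move=> [_ [i [_ [-> _ _]]]] [_ [j [_ [-> _ _]]]].
    by exists (e (p0 (i, j))), i, j.
  - by move=> [i [j [-> -> ->]]] [i' [j' [-> -> /einj/p0inj[<- <-]]]].
have [|X [PX Xmax]] := @Zorn_bigcup _ (fun X => pairing (X `|` X0)).
  move=> F FP Ftot; set U := \bigcup_(_ in _) _.
  have sub X t : F X -> (X `|` X0) t -> (U `|` X0) t.
    by move=> FX [Xt|]; [left; exists X|right].
  have domS X a : F X -> dom (X `|` X0) a -> dom (U `|` X0) a.
    by move=> FX [c Xc]; exists c; exact: sub Xc.
  have dom0 a : dom X0 a -> dom (U `|` X0) a by move=> [c Xc]; exists c; right.
  have two s t : (U `|` X0) s -> (U `|` X0) t ->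
      (X0 s /\ X0 t) \/ exists X, [/\ F X, (X `|` X0) s & (X `|` X0) t].
    move=> [[X FX Xs]|Xs] [[Y FY Yt]|Yt]; last by left.
    - right; have [XY|YX] := Ftot X Y FX FY.
        by exists Y; split=> //; left => //; exact: XY.
      by exists X; split=> //; left => //; exact: YX.
    - by right; exists X; split=> //; [left|right].
    - by right; exists Y; split=> //; [right|left].
  split=> [a b c abc|a b [c ac] [d bd]|a b a' b' c t t'].
  - have [[abc0 _]|[X [FX Xt _]]] := two _ _ abc abc.
      by case: PX0 => /(_ _ _ _ abc0)[? ? ?] _ _; split; exact: dom0.
    by case: (FP _ FX) => /(_ _ _ _ Xt)[? ? ?] _ _; split; exact: (domS X).
  - have [[ac0 bd0]|[X [FX Xs Xt]]] := two _ _ ac bd.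
      have [_ /(_ a b) tot _] := PX0; have [||x abx] := tot; [by exists c|by exists d|].
      by exists x; right.
    have [_ /(_ a b) tot _] := FP _ FX; have [||x abx] := tot; [by exists c|by exists d|].
    by exists x; exact: sub abx.
  - have [[t0 t0']|[X [FX Xs Xt]]] := two _ _ t t'.
      by case: PX0 => _ _ /(_ _ _ _ _ _ t0 t0').
    by case: (FP _ FX) => _ _ /(_ _ _ _ _ _ Xs Xt).
set Y := X `|` X0 in PX *; pose A := dom Y; case: PX => Yd Yt Yi.
have pex (u : {a | A a} * {a | A a}) : exists c : {a | A a}, Y (sval u.1, sval u.2, sval c).
  case: u => -[a Aa] [b Ab] /=; have [c abc] := Yt _ _ Aa Ab.
  by have [_ _ Ac] := Yd _ _ _ abc; exists (exist _ c Ac).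
pose p u := sval (cid (pex u)).
have pY u : Y (sval u.1, sval u.2, sval (p u)) := svalP (cid (pex u)).
have pinj : injective p.
  move=> u v e'; have := pY u; rewrite e' => /Yi /(_ (pY v)).
  by case: u v {e'} => -[a Aa] [b Ab] [[a' Aa'] [b' Ab']] /= [? ?]; subst;
    congr (_, _); exact: eq_exist.
have eA i : A (e i) by have [c ?] := dX0 i; exists c; right.
pose e' i : {a | A a} := exist _ (e i) (eA i).
have e'inj : injective e' by move=> i j /(congr1 sval)/einj. clearbody e'.
have [|] := card_le_total {a | ~ A a} {a | A a}.
  move=> /card_leTP[h hinj].
  pose f (x : K) : {a | A a} := match pselect (A x) with
    | left Ax => p (e' 0, exist _ x Ax)
    | right nAx => p (e' 1, h (exist _ x nAx)) end.
  have finj : injective f.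
    move=> x y; rewrite /f; case: pselect => Ax; case: pselect => Ay /pinj[] //.
    - by move=> /e'inj.
    - by move=> /e'inj.
    - by move=> /hinj/(congr1 sval).
  apply/card_leTP; exists (fun u => sval (p (f u.1, f u.2))) => -[a b] [a' b'].
  move=> /= euv; have : p (f a, f b) = p (f a', f b').
    by case: (p _) (p _) euv => [c Ac] [d Ad] /= ?; subst; exact: eq_exist.
  by move=> /pinj[/finj -> /finj ->].
move=> /card_leTP[h hinj].
have hN u : ~ A (sval (h u)) := svalP (h u).
have hI u v : sval (h u) = sval (h v) -> u = v.
  by move=> euv; apply: hinj; case: (h u) (h v) euv => [c Ac] [d Ad] /= ?; subst; exact: eq_exist.
have svI (u v : {a | A a}) : sval u = sval v -> u = v.
  by case: u v => [u Au] [v Av] /= ?; subst; exact: eq_exist.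
(* Only the copy [h] of the domain is adjoined. The tag [t] selects one of the three new parts of
   the square; every [t >= 2] stands for the third, whence [minn t 2]. The codes [q] lie in the
   copy, away from the old ones. *)
pose N t (u v : {a | A a}) : K * K := if t is 0 then (sval u, sval (h v))
  else if t is 1 then (sval (h u), sval v) else (sval (h u), sval (h v)).
pose q t u v := sval (h (p (e' (minn t 2), p (u, v)))).
pose Z : set (K * K * K) := [set x | exists t u v, x = (N t u v, q t u v)].
have qI t u v t' u' v' : q t u v = q t' u' v' -> [/\ minn t 2 = minn t' 2, u = u' & v = v'].
  by move=> /hI/pinj[/e'inj -> /pinj[-> ->]].
have NZ t u v : N t u v = N (minn t 2) u v by case: t => [|[|[|]]].
have dYZ a : dom (Y `|` Z) a <-> A a \/ exists u, a = sval (h u).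
  split=> [[c [Yc|]]|[[c Yc]|[u ->]]]; first by left; exists c.
  - move=> [[|[|t]] [u [v []]]] /=.
    + by move=> -> h0 _; case: (hN v); rewrite -h0; exact: (svalP u).
    + by move=> -> h0 _; case: (hN u); rewrite h0; exact: (svalP v).
    + by move=> -> _ _; right; exists u.
  - by exists c; left.
  - by exists (q 2 u u); right; exists 2, u, u.
have /Xmax : X `<` (Y `|` Z).
  split=> [t Xt|]; first by left; left.
  move=> /(_ (sval (h (e' 0)), sval (h (e' 0)), q 2 (e' 0) (e' 0))) Xh.
  apply: (hN (e' 0)); exists (q 2 (e' 0) (e' 0)); left; apply: Xh.
  by right; exists 2, (e' 0), (e' 0).
case; have -> : Y `|` Z `|` X0 = Y `|` Z.
  by apply/seteqP; split=> t; [case=> // ?; left; right|left].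
split=> [a b c|a b /dYZ da /dYZ db|a b a' b' c].
- case=> [/Yd[? ? ?]|[t [u [v]]]]; first by split; apply/dYZ; left.
  have sA (w : {a | A a}) : dom (Y `|` Z) (sval w) by apply/dYZ; left; exact: (svalP w).
  have sh w : dom (Y `|` Z) (sval (h w)) by apply/dYZ; right; exists w.
  by case: t => [|[|t]] [-> -> ->]; split; rewrite /q.
- case: da => [Aa|[u ->]]; case: db => [Ab|[v ->]].
  + by have [c ?] := Yt _ _ Aa Ab; exists c; left.
  + by exists (q 0 (exist _ a Aa) v); right; exists 0, (exist _ a Aa), v.
  + by exists (q 1 u (exist _ b Ab)); right; exists 1, u, (exist _ b Ab).
  + by exists (q 2 u v); right; exists 2, u, v.
- case=> [y1|[t [u [v [e1 ->]]]]] [y2|[t' [u' [v' [e2]]]]].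
  + exact: Yi y1 y2.
  + by move=> ec; have [_ _] := Yd _ _ _ y1; rewrite ec => /hN.
  + by have [_ _ /hN] := Yd _ _ _ y2.
  + move=> /qI[et eu ev]; move: e1 e2; rewrite NZ et eu ev -NZ => <- [].
    by move=> -> ->.
Qed.

End Square.

Lemma card_le_sigP (T : Type) (A : set T) (B : Type) :
  A #<= [set: B] <-> exists f : {x | A x} -> B, injective f.
Proof. by rewrite -card_leTP (card_le_eql (card_le_sig A)). Qed.

Lemma card_le_inP (T : Type) (A : set T) (B : Type) (b0 : B) :
  A #<= [set: B] ->
  exists f : T -> B, forall x y, A x -> A y -> f x = f y -> x = y.
Proof.
move=> /card_le_sigP[f finj].
exists (fun x => if pselect (A x) is left Ax then f (exist _ x Ax) else b0) => x y Ax Ay.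
by case: pselect => // Ax'; case: pselect => // Ay' /finj/(congr1 sval).
Qed.

Lemma in_card_le (T : Type) (A : set T) (B : Type) (f : T -> B) :
  (forall x y, A x -> A y -> f x = f y -> x = y) -> A #<= [set: B].
Proof.
move=> finj; apply/card_le_sigP; exists (fun u => f (sval u)) => -[x Ax] [y Ay] /=.
by move=> /finj exy; apply: eq_exist; exact: exy.
Qed.

Lemma finite_nat_ub (A : set nat) : finite_set A -> exists N, forall n, A n -> n < N.
Proof.
move=> /finite_seqP[s ->]; exists (\max_(i <- s) i).+1 => n ns.
by rewrite ltnS (@leq_bigmax_seq _ s xpredT id).
Qed.

Section InfiniteCard.
Variable K : Type.
Hypothesis Kinf : infinite_set [set: K].

Lemma infinite_inj_nat : exists e : nat -> K, injective e.
Proof. by apply/card_leTP/infiniteP. Qed.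

Lemma infinite_inj_pair : exists p : K * K -> K, injective p.
Proof. exact/card_leTP/square_card_le. Qed.

(** Lists are folded with the pairing. The length is recorded as well, since the code [e 0] of the
    empty list may be a value of [p]. *)
Lemma seq_card_le : [set: seq K] #<= [set: K].
Proof.
have [e einj] := infinite_inj_nat; have [p pinj] := infinite_inj_pair.
pose code := foldr (fun a c => p (a, c)) (e 0).
apply/card_leTP; exists (fun s => p (e (size s), code s)).
move=> s t /pinj[/einj]; elim: s t => [|a s IH] [|b t] //= [st].
by move=> /pinj[-> /IH ->].
Qed.

(** A point is coded by the index of a chosen set containing it and its position there. This gives
    the regularity of [succ_card K] later. *)
Lemma cover_card_le (I T : Type) (A : I -> set T) :
  [set: I] #<= [set: K] -> (forall i, A i #<= [set: K]) ->
  (forall t, exists i, A i t) -> [set: T] #<= [set: K].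
Proof.
move=> /card_leTP[i0 iinj] AK cov.
have [e einj] := infinite_inj_nat; have [p pinj] := infinite_inj_pair.
pose f i := sval (cid (card_le_inP (e 0) (AK i))).
have fP i : forall x y, A i x -> A i y -> f i x = f i y -> x = y.
  exact: (svalP (cid (card_le_inP (e 0) (AK i)))).
pose c t := sval (cid (cov t)); have cP t : A (c t) t := svalP (cid (cov t)).
apply/card_leTP; exists (fun t => p (i0 (c t), f (c t) t)) => s t /pinj[/iinj est].
by rewrite est; apply: fP => //; rewrite -est.
Qed.

Lemma setU1_card_le (T : Type) (A B : set T) (t : T) :
  A #<= [set: K] -> (forall b, B b -> b <> t -> A b) -> B #<= [set: K].
Proof.
have [e einj] := infinite_inj_nat; have [p pinj] := infinite_inj_pair.
move=> /(card_le_inP (e 0))[f finj] BA.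
apply: (@in_card_le _ _ _ (fun b => if pselect (b = t) then p (e 0, e 0) else p (e 1, f b))).
move=> x y Bx By; case: pselect => [xt|xt]; case: pselect => [yt|yt] //.
- by move=> _; rewrite xt yt.
- by move=> /pinj[/einj].
- by move=> /pinj[/einj].
- by move=> /pinj[/finj]; apply; exact: BA.
Qed.

End InfiniteCard.

(** * The linear order of an ordinal *)

Section OrdinalOrder.
Variable alpha : ordinal_number.
Implicit Types a b c : alpha.

Lemma ord_minimum (P : alpha -> Prop) :
  (exists a, P a) -> exists a, P a /\ forall b, P b -> ord_le a b.
Proof.
move=> [a Pa]; have [|z [[/asboolP Pz zmin] _]] := @ord_wo alpha (fun a => `[< P a >]).
  by exists a; apply/asboolP.
by exists z; split=> // b Pb; apply: zmin; apply/asboolP.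
Qed.

(** [well_order] provides unique minima of nonempty sets; this and the following order axioms are
    read off from sets of at most three elements. *)
Lemma ord_lexx a : ord_le a a.
Proof. by have [|_ [-> ]] := @ord_minimum (fun b => b = a); [exists a|exact]. Qed.

Lemma ord_le_total a b : ord_le a b \/ ord_le b a.
Proof.
have [|c [[->|->] cmin]] := @ord_minimum (fun c => c = a \/ c = b); first by exists a; left.
  by left; apply: cmin; right.
by right; apply: cmin; left.
Qed.

Lemma ord_le_anti a b : ord_le a b -> ord_le b a -> a = b.
Proof.
move=> ab ba; have [|z [_ zuniq]] := @ord_wo alpha (fun c => `[< c = a \/ c = b >]).
  by exists a; apply/asboolP; left.
rewrite -(zuniq a) ?(zuniq b)//; split=> [|c /asboolP[->|->]] //;
  by [apply/asboolP; auto|exact: ord_lexx].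
Qed.

Lemma ord_le_trans b a c : ord_le a b -> ord_le b c -> ord_le a c.
Proof.
move=> ab bc; have [|d [dE dmin]] := @ord_minimum (fun d => d = a \/ d = b \/ d = c).
  by exists a; left.
have da : ord_le d a by apply: dmin; auto.
have db : ord_le d b by apply: dmin; auto.
have dc : ord_le d c by apply: dmin; auto.
case: dE => [<-//|[e|e]]; subst d.
  by rewrite (ord_le_anti ab da).
by rewrite -(ord_le_anti bc db).
Qed.

Lemma ord_leNgt a b : ord_le a b <-> ~ ord_lt b a.
Proof. by rewrite /ord_lt; split=> [-> //|/negP]; rewrite negbK. Qed.

Lemma ord_lt_le a b : ord_lt a b -> ord_le a b.
Proof. by rewrite /ord_lt; case: (ord_le_total a b) => // ->. Qed.

Lemma ord_le_lt_trans b a c : ord_le a b -> ord_lt b c -> ord_lt a c.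
Proof. by move=> ab; apply: contra => ca; exact: ord_le_trans ca ab. Qed.

Lemma ord_lt_le_trans b a c : ord_lt a b -> ord_le b c -> ord_lt a c.
Proof. by move=> ab bc; apply: contra ab => ca; exact: ord_le_trans bc ca. Qed.

Lemma ord_ltxx a : ~ ord_lt a a.
Proof. by apply/ord_leNgt; exact: ord_lexx. Qed.

Lemma ord_le_eqVlt a b : ord_le a b -> a = b \/ ord_lt a b.
Proof.
move=> ab; have [ba|ba] := boolP (ord_le b a); last by right.
by left; exact: ord_le_anti.
Qed.

End OrdinalOrder.

(** * Ranks of graphs *)

Lemma linked_ind (G : graph) (u v : G) (P : G -> Prop) :
  linked u v -> P u -> (forall x y, P x -> adj x y -> P y) -> P v.
Proof.
move=> uv + Pstep; elim: uv => [x y xy|//|x y z _ IHxy _ IHyz /IHxy/IHyz //].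
by move=> Px; exact: Pstep xy.
Qed.

Lemma linked_trans (G : graph) (u v w : G) : linked u v -> linked v w -> linked u w.
Proof. exact: rt_trans. Qed.

Lemma linked_adj (G : graph) (u v : G) : adj u v -> linked u v.
Proof. by move=> uv; exact: (rt_step G (@adj G) u v uv). Qed.

Lemma linked_step (G : graph) (u v w : G) : linked u v -> adj v w -> linked u w.
Proof. by move=> uv vw; exact: linked_trans uv (linked_adj vw). Qed.

Lemma linked_sym (G : graph) (u v : G) : linked u v -> linked v u.
Proof.
move=> uv; apply: (linked_ind (P := fun x => linked x u) uv) => [|x y xu xy]; first exact: rt_refl.
exact: linked_trans (linked_adj (adj_sym xy)) xu.
Qed.

Lemma linked_map (G H : graph) (f : G -> H) (u v : G) :
  (forall x y, adj x y -> adj (f x) (f y)) -> linked u v -> linked (f u) (f v).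
Proof.
move=> fadj uv; apply: (linked_ind (P := fun x => linked (f u) (f x)) uv).
  exact: rt_refl.
move=> x y xu /fadj.
exact: linked_step.
Qed.

Lemma connected_from (G : graph) (u : G) :
  (forall v, linked u v) -> connected_graph G.
Proof.
move=> uG; split; first by exists u.
by move=> v w; exact: linked_trans (linked_sym (uG v)) (uG w).
Qed.

Lemma component_connected (G : graph) (C : set G) :
  is_component C -> connected_graph (induced C).
Proof.
move=> [u ->]; set C' := [set _ | _].
have Cu : C' u by exact: rt_refl.
apply: (@connected_from (induced C') (exist _ u Cu)) => -[v Cv].
suff [p] : exists p : C' v, linked (exist _ u Cu : induced C') (exist _ v p).
  by rewrite (Prop_irrelevance p Cv).
apply: (linked_ind (P := fun x => exists p : C' x,
  linked (exist _ u Cu : induced C') (exist _ x p)) Cv); first by exists Cu; exact: rt_refl.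
move=> x y [Cx ux] xy; exists (linked_step Cx xy).
exact: (linked_step ux).
Qed.

Lemma immersion_comp (G H I : graph) (f : G -> H) (g : H -> I) :
  immersion f -> immersion g -> immersion (g \o f).
Proof.
move=> [finj fadj] [ginj gadj]; split; first exact: inj_comp.
by move=> u v /fadj/gadj.
Qed.

Lemma strong_immersion_comp (G H I : graph) (f : G -> H) (g : H -> I) :
  strong_immersion f -> strong_immersion g -> strong_immersion (g \o f).
Proof.
move=> [finj fadj] [ginj gadj]; split; first exact: inj_comp.
by move=> u v; rewrite fadj gadj.
Qed.

Lemma strong_immersionW (G H : graph) (f : G -> H) :
  strong_immersion f -> immersion f.
Proof. by move=> [finj fadj]; split=> // u v /fadj. Qed.

Lemma induced_immersion (G : graph) (S : set G) :
  immersion (fun u : induced S => sval u : G).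
Proof.
by split=> // -[u Su] [v Sv] /= e; exact: eq_exist.
Qed.

Definition ray_adj (i j : nat) : Prop := j = i.+1 \/ i = j.+1.

Lemma ray_adj_sym i j : ray_adj i j -> ray_adj j i.
Proof. by case; [right|left]. Qed.

Lemma ray_adj_irrefl i : ~ ray_adj i i.
Proof. by case=> /n_Sn. Qed.

Definition ray_graph : graph := Graph ray_adj_sym ray_adj_irrefl.

Section Rank.
Variable alpha : ordinal_number.
Implicit Types (a b : alpha) (G H : graph).

Definition rank_le a (G : graph) : Prop := exists2 b, ord_le b a & has_rank b G.

(** For upper bounds on the rank, the recursion needs neither a separate finite case nor the
    exclusion of smaller ranks: a finite graph is deleted entirely, leaving no components. *)
Lemma rank_leE a G : rank_le a G <->
  exists F : set G, finite_set F /\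
    forall C : set (delete_vertices F), is_component C ->
      exists2 b, ord_lt b a & rank_le b (induced C).
Proof.
split=> [[b ba /has_rankE[[bmin Gfin]|[_ _ [F [Ffin FP]]]]]|[F [Ffin FP]]].
- by exists setT; split=> // C [[u nTu]]; case: nTu.
- exists F; split=> // C /FP[c cb cC].
  by exists c; [exact: ord_lt_le_trans cb ba|exists c => //; exact: ord_lexx].
- have [[b ba bG]|nG] := pselect (exists2 b, ord_lt b a & has_rank b G).
    by exists b => //; exact: ord_lt_le.
  exists a; first exact: ord_lexx.
  apply/has_rankE; have [[b ba]|amin] := pselect (exists b, ord_lt b a).
    right; split=> //; first by exists b.
    exists F; split=> // C /FP[c ca [d dc dC]].
    by exists d => //; exact: ord_le_lt_trans dc ca.
  (* For the least [a], no component can have smaller rank, so there is none and [F] contains every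
     vertex. *)
  left; split=> [b ba|]; first by apply: amin; exists b.
  apply: sub_finite_set Ffin => u _; apply: contrapT => nFu.
  have [|b ba _] := FP [set v | linked (exist _ u nFu : delete_vertices F) v].
    by exists (exist _ u nFu).
  by apply: amin; exists b.
Qed.

(** The preimage of a witness [F] is a witness: each component left in [H] is mapped into a single
    component of [G - F]. *)
Lemma rank_le_immersion a (G H : graph) (f : H -> G) :
  immersion f -> rank_le a G -> rank_le a H.
Proof.
elim/(well_founded_ind (@ord_lt_wf alpha)): a G H f => a IH G H f [finj fadj].
move=> /rank_leE[F [Ffin FP]]; apply/rank_leE; exists (f @^-1` F); split.
  by apply: finite_preimage Ffin => x y _ _ /finj.
move=> C [u0 ->].
pose g (x : delete_vertices (f @^-1` F)) : delete_vertices F := exist _ (f (sval x)) (svalP x).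
have gadj x y : adj x y -> adj (g x) (g y) by exact: fadj.
have [|b ba bC] := FP [set v | linked (g u0) v]; first by exists (g u0).
exists b => //; pose h (x : induced [set v | linked u0 v]) : induced [set v | linked (g u0) v] :=
  exist _ (g (sval x)) (linked_map gadj (svalP x)).
apply: (IH b ba _ _ h) bC; split=> [[[x Fx] ux] [[y Fy] uy]|[[x Fx] ux] [[y Fy] uy]].
  by move=> /(congr1 (fun z => sval (sval z)))/finj /= e; subst; do 2! apply: eq_exist.
exact: fadj.
Qed.

(** A connected graph immersed off [F] lies in one component. With its converse [avoiding_rank_le],
    this form replaces components, and thus nested subtypes, in what follows. *)
Lemma rank_le_avoiding a G : rank_le a G ->
  exists F : set G, finite_set F /\
    forall (H : graph) (f : H -> G), connected_graph H -> immersion f ->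
      (forall x, ~ F (f x)) -> exists2 b, ord_lt b a & rank_le b H.
Proof.
move=> /rank_leE[F [Ffin FP]]; exists F; split=> // H f [[x0 _] Hconn] [finj fadj] fF.
pose g x : delete_vertices F := exist _ (f x) (fF x).
have gadj x y : adj x y -> adj (g x) (g y) by exact: fadj.
have [|b ba bC] := FP [set v | linked (g x0) v]; first by exists (g x0).
exists b => //; pose h x : induced [set v | linked (g x0) v] :=
  exist _ (g x) (linked_map gadj (Hconn x0 x)).
apply: (rank_le_immersion (f := h)) bC; split=> [x y|x y]; last exact: fadj.
by move=> /(congr1 (fun z => sval (sval z)))/finj.
Qed.

Lemma avoiding_rank_le a G (F : set G) : finite_set F ->
  (forall (H : graph) (f : H -> G), connected_graph H -> immersion f ->
      (forall x, ~ F (f x)) -> exists2 b, ord_lt b a & rank_le b H) ->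
  rank_le a G.
Proof.
move=> Ffin FP; apply/rank_leE; exists F; split=> // C Ccomp.
apply: (FP (induced C) (fun u => sval (sval u))).
- exact: component_connected.
- exact: (immersion_comp (induced_immersion C) (induced_immersion (~` F))).
- by move=> u; exact: (svalP (sval u)).
Qed.

Lemma rank_le_ord_le a b G : ord_le a b -> rank_le a G -> rank_le b G.
Proof. by move=> ab [c ca cG]; exists c => //; exact: ord_le_trans ca ab. Qed.

(** A ray has a tail avoiding the finite witness. Hence [ray_graph] itself has smaller rank, and it
    contains a ray, contrary to induction. *)
Lemma rank_le_rayless a G : rank_le a G -> rayless G.
Proof.
move=> aG [r [rinj radj]].
have : immersion (r : ray_graph -> G).
  by split=> // i j [->|->] //; exact: adj_sym.
elim/(well_founded_ind (@ord_lt_wf alpha)): a G aG r {rinj radj} => a IH G.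
move=> /rank_le_avoiding[F [Ffin FP]] r [rinj radj].
have [|N NP] := @finite_nat_ub (r @^-1` F).
  by apply: finite_preimage Ffin => x y _ _ /rinj.
have [||//|b ba bray] := FP ray_graph (fun n => r (N + n)).
- apply: (@connected_from ray_graph 0); elim=> [|n IHn]; first exact: rt_refl.
  by apply: (linked_step IHn); left.
- split=> [i j /rinj /addnI //|i j ij]; apply: radj.
  by case: ij => ->; rewrite addnS; [left|right].
- by move=> n /NP; rewrite ltnNge leq_addr.
by apply: (IH b ba _ bray id); split.
Qed.

(** Delete [y] together with a witness for each of the finitely many colour classes in [J]. A
    connected graph avoiding these is monochromatic, since edges off [y] preserve the colour. *)
Lemma rank_le_label a G (I : Type) (y : G) (c : G -> I) (J : set I) :
  finite_set J ->
  (forall u v, u <> y -> v <> y -> adj u v -> c u = c v) ->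
  (forall v, v <> y -> J (c v) ->
     rank_le a (induced [set u | u <> y /\ c u = c v])) ->
  (forall v, v <> y -> ~ J (c v) ->
     exists2 b, ord_lt b a & rank_le b (induced [set u | u <> y /\ c u = c v])) ->
  rank_le a G.
Proof.
move=> Jfin cadj JP nJP; pose S i : set G := [set u | u <> y /\ c u = i].
have ex i : exists F : set (induced (S i)), finite_set F /\
    (J i -> forall (H : graph) (f : H -> induced (S i)), connected_graph H -> immersion f ->
      (forall x, ~ F (f x)) -> exists2 b, ord_lt b a & rank_le b H).
  have [[v [vy ? Jv]]|no] := pselect (exists v, [/\ v <> y, c v = i & J i]).
    subst i; have [F [Ffin FP]] := rank_le_avoiding (JP v vy Jv).
    by exists F.
  exists set0; split=> [|Ji H f [[x _] _]]; first exact: finite_set0.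
  by case: no; exists (sval (f x)); have [] := svalP (f x).
pose F i := sval (cid (ex i)).
have Ffin i : finite_set (F i) by case: (svalP (cid (ex i))).
have FP i := (svalP (cid (ex i))).2.
apply: (@avoiding_rank_le _ _ ([set y] `|` \bigcup_(i in J) [set sval u | u in F i])).
  rewrite finite_setU; split; first exact: finite_set1.
  by apply: bigcup_finite => // i Ji; exact: finite_image.
move=> H f Hconn [finj fadj] fF.
have fy x : f x <> y by move=> fxy; apply: (fF x); left.
case: (Hconn) => -[x0 _] Hl.
have cf x : c (f x) = c (f x0).
  apply: (linked_ind (P := fun x => c (f x) = c (f x0)) (Hl x0 x)) => // u v <- uv.
  by apply/esym/cadj => //; exact: fadj.
pose g x : induced (S (c (f x0))) := exist _ (f x) (conj (fy x) (cf x)).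
have gimm : immersion g.
  by split=> [u v /(congr1 sval)/finj|u v /fadj].
have [Jx|nJx] := pselect (J (c (f x0))).
  apply: (FP _ Jx _ g) => // x Fx; apply: (fF x); right.
  by exists (c (f x0)) => //; exists (g x).
have [b ba bS] := nJP _ (fy x0) nJx.
by exists b => //; exact: rank_le_immersion gimm bS.
Qed.

End Rank.

(** * Universal trees *)

(** A highest vertex of a cycle would have two lower neighbours. *)
Lemma leveled_acyclic (G : graph) (h : G -> nat) :
  (forall u v, adj u v -> h v = (h u).+1 \/ h u = (h v).+1) ->
  (forall u v w, adj u v -> adj u w -> h u = (h v).+1 -> h u = (h w).+1 -> v = w) ->
  forall C, cycles C -> ~ immerses C G.
Proof.
move=> hstep huniq C [n ->] [f [finj fadj]].
pose k i := h (f (insubd (exist _ 0 isT : cycle_vertex n) i)).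
pose s := [seq k i | i <- iota 0 n.+3].
have [i0 hmax] : exists i : cycle_vertex n, forall j, h (f j) <= h (f i).
  pose P m := `[< exists i : cycle_vertex n, h (f i) = m >].
  have exP : exists m, P m by exists (h (f (exist _ 0 isT))); apply/asboolP; exists (exist _ 0 isT).
  have bP m : P m -> m <= \max_(m <- s) m.
    move=> /asboolP[i <-]; apply: (@leq_bigmax_seq _ s xpredT id) => //.
    apply/mapP; exists (sval i); first by rewrite mem_iota add0n (svalP i).
    rewrite /k; congr (h (f _)); apply: val_inj; rewrite val_insubd.
    by rewrite (svalP i).
  case: (ex_maxnP exP bP) => m /asboolP[i <-] imax; exists i => j.
  by apply: imax; apply/asboolP; exists j.
have modP (i : nat) : i %% n.+3 < n.+3 by rewrite ltn_mod.
pose a : cycle_vertex n := exist (fun i => i < n.+3) _ (modP (sval i0).+1).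
(* The predecessor of [i0], as [n.+2] is -1 modulo [n.+3]. *)
pose b : cycle_vertex n := exist (fun i => i < n.+3) _ (modP (sval i0 + n.+2)).
have ia : @adj (cycle_graph n) i0 a by left.
have ib : @adj (cycle_graph n) i0 b.
  have ar i N : i < N.+1 -> i = ((i + N) %% N.+1).+1 %% N.+1.
    by move=> iN; rewrite -addn1 modnDml -addnA addn1 modnDr modn_small.
  by right; exact: ar (svalP i0).
have down j : @adj (cycle_graph n) i0 j -> h (f i0) = (h (f j)).+1.
  move=> /fadj/hstep[e|//]; have := hmax j.
  by rewrite e ltnn.
have /finj/(congr1 sval)/= : f a = f b.
  by apply: (huniq (f i0)); [exact: fadj|exact: fadj|exact: down|exact: down].
move=> /eqP; rewrite -[(sval i0).+1]addn1 eqn_modDl !modn_small //.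
Qed.

Section UniversalTree.
Variables (alpha : ordinal_number) (K : Type) (e : nat -> K).
Hypothesis Kinf : infinite_set [set: K].
Hypothesis einj : injective e.

Definition label : Type := alpha * nat * K.

Implicit Types (x y z : label) (s t : seq label) (a b : alpha).

Definition child x y : Prop :=
  ord_lt y.1.1 x.1.1 \/
  [/\ y.1.1 = x.1.1, y.1.2 < x.1.2 & exists2 i, i < x.1.2 & y.2 = e i].

Fixpoint valid x s : Prop := if s is y :: s' then child x y /\ valid y s' else True.

Definition utree_adj x (s t : {s | valid x s}) : Prop :=
  (exists y, sval t = rcons (sval s) y) \/ exists y, sval s = rcons (sval t) y.

Lemma utree_adj_sym x (s t : {s | valid x s}) : utree_adj s t -> utree_adj t s.
Proof. by case; [right|left]. Qed.

Lemma utree_adj_irrefl x (s : {s | valid x s}) : ~ utree_adj s s.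
Proof. by case=> -[y /(congr1 size)]; rewrite size_rcons => /n_Sn. Qed.

Definition utree x : graph := Graph (@utree_adj_sym x) (@utree_adj_irrefl x).

Definition uroot x : utree x := exist _ [::] Logic.I.

Lemma valid_nil x (xs : valid x [::]) : exist _ [::] xs = uroot x.
Proof. exact: eq_exist. Qed.

Lemma valid_rcons x s y : valid x (rcons s y) -> valid x s.
Proof. by elim: s x => //= z s IH x [? /IH]. Qed.

Lemma utree_connected x : connected_graph (utree x).
Proof.
apply: (@connected_from _ (uroot x)) => -[s]; elim/last_ind: s => [|s y IH] xs.
  by rewrite (Prop_irrelevance xs Logic.I); exact: rt_refl.
by apply: (linked_step (IH (valid_rcons xs))); left; exists y.
Qed.

Lemma utree_acyclic x C : cycles C -> ~ immerses C (utree x).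
Proof.
apply: (@leveled_acyclic _ (fun s : utree x => size (sval s))).
  by move=> [s xs] [t xt] [] /= [y ->]; rewrite size_rcons; [left|right].
have down (u v : utree x) : adj u v -> size (sval u) = (size (sval v)).+1 ->
    exists y, sval u = rcons (sval v) y.
  by case=> // -[y ->]; rewrite size_rcons => /esym/eqP; rewrite -addn2 -{2}[size _]addn0 eqn_add2l.
move=> u [s xs] [t xt] /down us /down ut /us[y uy] /ut[z]; rewrite uy => /= /rcons_inj[st _].
exact: eq_exist.
Qed.

Lemma subtree_valid x y s : child x y -> valid y s -> valid x (y :: s).
Proof. by []. Qed.

Definition subtree x y (xy : child x y) (s : utree y) : utree x :=
  exist _ (y :: sval s) (subtree_valid xy (svalP s)).

Lemma subtree_strong_immersion x y (xy : child x y) : strong_immersion (subtree xy).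
Proof.
split=> [[s ys] [t yt] /(congr1 sval)[/= st]|[s ys] [t yt]]; first exact: eq_exist.
split; case=> -[z /= st].
- by left; exists z; rewrite /= st.
- by right; exists z; rewrite /= st.
- by left; exists z; move: st => [].
- by right; exists z; move: st => [].
Qed.

Lemma behead_valid x y (u : induced [set s : utree x | s <> uroot x /\ head x (sval s) = y]) :
  valid y (behead (sval (sval u))).
Proof.
case: u => -[[|z s] xs] [/= nr zy]; first by case: nr; exact: eq_exist.
by move: zy => /= <-; exact: xs.2.
Qed.

Lemma immersion_branch x y :
  immersion (fun u : induced [set s : utree x | s <> uroot x /\ head x (sval s) = y] =>
    exist _ (behead (sval (sval u))) (behead_valid u) : utree y).
Proof.
split=> [[[s xs] [sr sy]] [[t xt] [tr ty]] /(congr1 sval)|[[s xs] [sr sy]] [[t xt] [tr ty]]] /=.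
  case: s t xs sr sy xt tr ty => [|z s] [|w t] xs sr sy xt tr ty.
  1-3: by [case: sr; exact: valid_nil|case: tr; exact: valid_nil].
  move=> /= st; do 2! apply: eq_exist; rewrite st; congr (_ :: _).
  by move: sy ty => /= -> ->.
case: s t xs sr sy xt tr ty => [|z s] [|w t] xs sr sy xt tr ty.
1-3: by [case: sr; exact: valid_nil|case: tr; exact: valid_nil].
by case=> -[v [_ st]]; [left|right]; exists v.
Qed.

(** Induction on [c], then on [m]. The branches at the root are labelled by their first letter: only
    finitely many letters, those in [J], keep the rank [c], and these lower [m]. *)
Lemma rank_le_utree x : rank_le x.1.1 (utree x).
Proof.
move: x => [[c m] k] /=; elim/(well_founded_ind (@ord_lt_wf alpha)): c m k => c IHc m.
elim/ltn_ind: m => m IHm k; set x := (c, m, k).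
pose J : set label := [set (c, p.1, e p.2) | p in `I_m `*` `I_m].
apply: (@rank_le_label _ _ (utree x) _ (uroot x) (fun s : utree x => head x (sval s)) J).
- by apply: finite_image; apply: finite_setX; exact: finite_II.
- move=> [[|y s] xs] [[|z t] xt] ur vr;
    try by [case: ur; exact: valid_nil|case: vr; exact: valid_nil].
  by case=> -[w /= [yz _]]; rewrite /= yz.
- move=> s sr [[m' i] /= [im jm] yE]; rewrite -yE.
  by apply: (rank_le_immersion (@immersion_branch _ _)); exact: IHm.
- move=> [[|y s] xs] sr /= nJ; first by case: sr; exact: eq_exist.
  have := xs.1; case: y {xs sr} nJ => [[b m'] k'] nJ xy.
  have bc : ord_lt b c.
    case: xy => // -[/= bc m'm [i im ki]]; case: nJ; subst b k'.
    by exists (m', i).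
  exists b => //; apply: (rank_le_immersion (@immersion_branch _ _)); exact: IHc.
Qed.

(** If [b] were below [x.1.1], some of the infinitely many branches [utree (b, 0, k)] would avoid
    the finite witness and so have rank below [b], contrary to induction. *)
Lemma rank_le_utree_ord_le x b : rank_le b (utree x) -> ord_le x.1.1 b.
Proof.
elim/(well_founded_ind (@ord_lt_wf alpha)): b x => b IH x bx.
apply/ord_leNgt => bltx.
have [F [Ffin FP]] := rank_le_avoiding bx.
have [k kF] : exists k, forall s : utree x, F s -> (head x (sval s)).2 <> k.
  apply: contrapT => /forallNP no; apply: Kinf.
  apply: (@sub_finite_set _ _ [set (head x (sval s)).2 | s in F]); last exact: finite_image.
  move=> k _; apply: contrapT => nk; apply: (no k) => s Fs sk; apply: nk.
  by exists s.
pose y : label := (b, 0, k); have xy : child x y by left.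
have [|||c cb /IH] := FP (utree y) (subtree xy).
- exact: utree_connected.
- exact/strong_immersionW/subtree_strong_immersion.
- by move=> s /kF; apply.
by move=> /(_ cb)/= /ord_leNgt; apply.
Qed.

Lemma rank_le_utree_bound (c : alpha) (G : graph) : rank_le c G ->
  exists n, forall m k, immerses (utree (c, m, k)) G -> m <= n.
Proof.
move=> /rank_le_avoiding[F [[n Fn] FP]]; exists n => m k [f fimm].
set x : label := (c, m, k).
(* The bound [n] is the size of [F]: each of the [m] disjoint branches at [(c, 0, e i)] has a vertex
   sent into [F]. For [i >= m] the root is a default value. *)
have ex i : exists s : utree x, i < m -> F (f s) /\ (head x (sval s)).2 = e i.
  have [im|] := boolP (i < m); last by exists (uroot x).
  pose y : label := (c, 0, e i).
  have xy : child x y by right; split=> //=; [exact: leq_ltn_trans im|exists i].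
  apply: contrapT => no.
  have [||s Fs|b bc /rank_le_utree_ord_le /= /ord_leNgt] := FP (utree y) (f \o subtree xy).
  - exact: utree_connected.
  - exact: immersion_comp (strong_immersionW (subtree_strong_immersion xy)) fimm.
  - by apply: no; exists (subtree xy s).
  - exact.
pose g i := sval (cid (ex i)).
have gP i : i < m -> F (f (g i)) /\ (head x (sval (g i))).2 = e i := svalP (cid (ex i)).
have : [set f (g i) | i in `I_m] #= `I_m.
  apply: inj_card_eq => i j; rewrite !inE /= => /gP[_ ei] /gP[_ ej] /fimm.1 gij.
  by apply: einj; rewrite -ei -ej gij.
rewrite card_eq_sym -card_le_II => /card_eqPle[h _].
apply: (card_le_trans h); move: Fn => /card_eqPle[Fn _]; apply: card_le_trans Fn.
by apply: subset_card_le => _ [i /= im <-]; have [] := gP i im.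
Qed.

Lemma utree_rayless x : rayless (utree x).
Proof. exact: rank_le_rayless (rank_le_utree x). Qed.

Hypothesis segK : forall a, [set b | ord_lt b a] #<= [set: K].

(** [alpha] may exceed [K] in cardinality, but ranks never increase along a vertex, so it suffices
    that [j] codes the ranks up to [x.1.1] injectively. *)
Lemma utree_card_le x : [set: utree x] #<= [set: K].
Proof.
have [p pinj] := infinite_inj_pair Kinf.
have [j jinj] : exists j : alpha -> K,
    forall a b, ord_le a x.1.1 -> ord_le b x.1.1 -> j a = j b -> a = b.
  apply: (card_le_inP (e 0) (A := [set a | ord_le a x.1.1])).
  by apply: (setU1_card_le Kinf (t := x.1.1) (segK x.1.1)) => b /ord_le_eqVlt[].
pose code (y : label) := p (p (j y.1.1, e y.1.2), y.2).
have [q qinj] := (card_leTP _ _).1 (seq_card_le Kinf).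
apply/card_leTP; exists (fun s : utree x => q (map code (sval s))).
move=> [s xs] [t xt] /= /qinj st; apply: eq_exist.
have child_le y z : child y z -> ord_le y.1.1 x.1.1 -> ord_le z.1.1 x.1.1.
  by case=> [/ord_lt_le zy yx|[-> _ _]] //; exact: ord_le_trans zy yx.
suff inj_code u v x1 x2 : map code u = map code v -> valid x1 u ->
    valid x2 v -> ord_le x1.1.1 x.1.1 -> ord_le x2.1.1 x.1.1 -> u = v.
  by apply: (inj_code s t x x) => //; exact: ord_lexx.
move: u v x1 x2 {s t st xs xt}; elim=> [|y s IH] [|z t] //= x1 x2.
move=> [/pinj[/pinj[jyz /einj yz2] yz3] st].
move=> [xy ys] [xz zt] x1x x2x.
have yx := child_le _ _ xy x1x; have zx := child_le _ _ xz x2x.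
rewrite (IH t _ _ st ys zt) //; congr (_ :: _); move: jyz yz2 yz3 => /(jinj _ _ yx zx).
by case: y z {xy ys xz zt yx zx} => [[b m] k] [[b' m'] k'] /= -> -> ->.
Qed.

Lemma utree_class x :
  kappa_rayless_avoiding K cycles (utree x) /\ rank_le x.1.1 (utree x).
Proof.
split; last exact: rank_le_utree.
split; last exact: utree_acyclic.
by split; [exact: utree_connected|exact: utree_rayless|exact: utree_card_le].
Qed.

End UniversalTree.

(** * Branches of rayless trees *)

Section Reach.
Variable G : graph.
Implicit Types (S A : set G) (u v y z : G).

(** Walks whose vertices after [z] lie in [A]. Stating connectivity inside [A] on [G] itself avoids
    subtypes. *)
Inductive reach A z : G -> Prop :=
| reach_refl : reach A z z
| reach_step u v : reach A z u -> adj u v -> A v -> reach A z v.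

Lemma reach_sub A z v : A z -> reach A z v -> A v.
Proof. by move=> Az; case. Qed.

Lemma reach_trans A z u v : reach A z u -> reach A u v -> reach A z v.
Proof. by move=> zu; elim=> // x w _ zx xw Aw; exact: reach_step zx xw Aw. Qed.

Lemma reach_sym A z v : A z -> reach A z v -> reach A v z.
Proof.
move=> Az; elim=> [|u w zu uz uw Aw]; first exact: reach_refl.
apply: reach_trans uz; apply: (reach_step (@reach_refl _ _) (adj_sym uw)).
exact: reach_sub zu.
Qed.

Lemma reach_connected A z : A z -> connected_graph (induced (reach A z)).
Proof.
move=> Az; have r0 : reach A z z by exact: reach_refl.
apply: (@connected_from (induced (reach A z)) (exist _ z r0)) => -[v zv].
suff [p] : exists p : reach A z v,
    linked (exist _ z r0 : induced (reach A z)) (exist _ v p).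
  by rewrite (Prop_irrelevance p zv).
elim: zv => [|u w _ [zu lu] uw Aw]; first by exists r0; exact: rt_refl.
by exists (reach_step zu uw Aw); apply: (linked_step lu).
Qed.

Lemma sub_rank_le (alpha : ordinal_number) (c : alpha) A B :
  A `<=` B -> rank_le c (induced B) -> rank_le c (induced A).
Proof.
move=> AB; apply: (rank_le_immersion
  (f := fun u : induced A => exist _ (sval u) (AB _ (svalP u)) : induced B)).
by split=> // -[u Au] [v Av] /(congr1 sval) /= uv; exact: eq_exist.
Qed.

Definition piece S y : Prop := S y /\ forall v, S v -> reach S y v.

(** For a neighbour [z] of [y] in [S], this is the component of [z] once [y] is deleted from [S]. *)
Definition branch S y z : set G := reach (S `\ y) z.

Lemma branch_sub S y z : S z -> adj y z -> branch S y z `<=` S `\ y.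
Proof.
move=> Sz yz v; apply: reach_sub; split=> // zy.
by move: yz; rewrite zy; exact: adj_irrefl.
Qed.

Lemma reach_piece A z : piece (reach A z) z.
Proof.
split=> [|v]; first exact: reach_refl.
elim=> [|u w zu IH uw Aw]; first exact: reach_refl.
by apply: (reach_step IH uw); exact: reach_step zu uw Aw.
Qed.

(** On a walk from [y] to [v], take the vertex following the last visit to [y]. *)
Lemma branch_cover S y v : piece S y -> S v -> v <> y ->
  exists z, [/\ S z, adj y z & branch S y z v].
Proof.
move=> [Sy /[apply]]; elim=> // u w yu IH uw Sw wy.
have [uy|uy] := pselect (u = y).
  by exists w; split=> //; [rewrite -uy|exact: reach_refl].
by have [z [Sz yz zu]] := IH uy; exists z; split=> //; exact: reach_step zu uw _.
Qed.

Hypothesis Gacyclic : forall C, cycles C -> ~ immerses C G.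

(** A path without repetitions from [z] to [z'] in [A] would be closed to a cycle by [y]. *)
Lemma reach_cycle A y z z' : adj y z -> adj y z' -> A z -> ~ A y ->
  reach A z z' -> z = z'.
Proof.
move=> yz yz' Az nAy zz'; apply: contrapT => zNz'.
pose T : eqType := {classic G}.
pose E : rel T := fun u v => `[< adj (u : G) (v : G) >].
have [p [pE pA plast]] : exists p : seq T,
    [/\ path E z p, forall i, i \in (z : T) :: p -> A i & last (z : T) p = z'].
  elim: zz' {yz' zNz'} => [|u w _ [p [pE pA plast]] uw Aw].
    by exists [::]; split=> // i; rewrite inE => /eqP ->.
  exists (rcons p w); split.
  - by rewrite rcons_path pE plast; apply/asboolP.
  - by move=> i; rewrite -rcons_cons mem_rcons inE => /orP[/eqP -> //|]; exact: pA.
  - by rewrite last_rcons.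
case: (shortenP pE) plast => q qE quniq qsub qlast.
have {}qsub i : i \in (z : T) :: q -> A i.
  by rewrite inE => /orP[/eqP -> //|/qsub iq]; apply: pA; rewrite inE iq orbT.
(* As [z] and [z'] differ, the path has a second vertex, so that with [y] at least three vertices
   are on the cycle. *)
case: q qE quniq qlast qsub => [|x q] qE quniq qlast qsub; first exact: zNz'.
pose c : seq T := [:: (y : T), (z : T), x & q].
have cuniq : uniq c.
  by rewrite /= in quniq *; rewrite quniq andbT; apply/negP => /qsub.
have cE : path E y ((z : T) :: x :: q) by rewrite /= in qE *; rewrite qE andbT; apply/asboolP.
have csize : size c = (size q).+3 by [].
apply: (Gacyclic (C := cycle_graph (size q))); first by exists (size q).
exists (fun i => nth (y : T) c (sval i)); split.
  move=> [i ic] [j jc] /= ij; apply: eq_exist.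
  by apply/eqP; rewrite -(nth_uniq (y : T) (s := c)) //; apply/eqP.
have step (i j : nat) : i < (size q).+3 -> j = i.+1 %% (size q).+3 ->
    adj (nth (y : T) c i : G) (nth (y : T) c j).
  rewrite leq_eqVlt => /orP[/eqP[->]|il].
    rewrite modnn => ->; apply: adj_sym.
    rewrite /= -[nth _ _ _]/(nth (y : T) ((z : T) :: x :: q) (size q).+1).
    rewrite (_ : (size q).+1 = (size ((z : T) :: x :: q)).-1) // nth_last.
    by rewrite -[last _ _]/(last (z : T) (x :: q)) qlast.
  rewrite modn_small // => ->.
  by have /(pathP (y : T))/(_ i)/= := cE; rewrite -ltnS => /(_ il)/asboolP.
by move=> [i il] [j jl] []; [move=> /= h; exact: step|move=> /= h; apply: adj_sym; exact: step].
Qed.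

Lemma branch_inj S y z z' v : S z -> S z' -> adj y z -> adj y z' ->
  branch S y z v -> branch S y z' v -> z = z'.
Proof.
move=> Sz Sz' yz yz' zv z'v.
have Nz x : adj y x -> x <> y by move=> yx xy; move: yx; rewrite xy; exact: adj_irrefl.
apply: (reach_cycle (A := S `\ y) yz yz'); first by split=> //; exact: Nz.
  by move=> -[_]; apply.
apply: (reach_trans zv); apply: reach_sym z'v; split=> //; exact: Nz.
Qed.

Hypothesis Grayless : rayless G.

(** A counterexample has a branch that is a counterexample, and so on. The roots of these branches
    form a ray: each root is deleted from all later branches, so they are distinct. *)
Lemma piece_ind (P : set G -> G -> Prop) :
  (forall S y, piece S y -> (forall z, S z -> adj y z -> P (branch S y z) z) -> P S y) ->
  forall S y, piece S y -> P S y.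
Proof.
move=> Pbranch S0 y0 pc0; apply: contrapT => nP0.
pose Q := {q : set G * G | piece q.1 q.2 /\ ~ P q.1 q.2}.
have next (q : Q) : exists q' : Q, [/\ (sval q).1 (sval q').2, adj (sval q).2 (sval q').2 &
    (sval q').1 = branch (sval q).1 (sval q).2 (sval q').2].
  case: q => -[S y] /= [pc nP]; apply: contrapT => no; apply: nP.
  apply: Pbranch => // z Sz yz; apply: contrapT => nPz; apply: no.
  by exists (exist _ (branch S y z, z) (conj (@reach_piece _ _) nPz)).
pose f q := sval (cid (next q)).
have fP q := svalP (cid (next q)).
pose q0 : Q := exist _ (S0, y0) (conj pc0 nP0).
pose q n := iter n f q0; pose r n := (sval (q n)).2.
have radj n : adj (r n) (r n.+1) by case: (fP (q n)).
have dec n : (sval (q n.+1)).1 `<=` (sval (q n)).1 `\ r n.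
  by case: (fP (q n)) => h1 h2 h3; rewrite /q iterS -/(q n) h3; exact: branch_sub.
have decs m n : (sval (q (m + n))).1 `<=` (sval (q m)).1.
  elim: n => [|n IHn]; first by rewrite addn0.
  by rewrite addnS => x /dec[/IHn xm _].
have lt_neq i j : i < j -> r i <> r j.
  move=> ij rij; have qij := decs i.+1 (j - i.+1); rewrite subnKC // in qij.
  have : (sval (q j)).1 (r j) by case: (svalP (q j)) => -[].
  by move=> /qij/dec[_]; rewrite -rij; apply.
apply: Grayless; exists r; split=> // i j rij.
by case: (ltngtP i j) => // /lt_neq; rewrite rij.
Qed.

Section Root.
Variables (S : set G) (y : G).
Hypothesis pc : piece S y.

Lemma branch_root_ex v : exists z, S v -> v <> y -> [/\ S z, adj y z & branch S y z v].
Proof.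
have [[Sv vy]|no] := pselect (S v /\ v <> y).
  by have [z ?] := branch_cover pc Sv vy; exists z.
by exists y => Sv vy; case: no.
Qed.

Definition branch_root v : G := sval (cid (branch_root_ex v)).

Lemma branch_rootP v : S v -> v <> y ->
  [/\ S (branch_root v), adj y (branch_root v) & branch S y (branch_root v) v].
Proof. exact: (svalP (cid (branch_root_ex v))). Qed.

Lemma branch_rootE z v : S z -> adj y z -> branch S y z v -> branch_root v = z.
Proof.
move=> Sz yz zv; have [Sv vy] := branch_sub Sz yz zv.
by have [? ? h] := branch_rootP Sv vy; exact: branch_inj h zv.
Qed.

Lemma branch_root_adj u v : S u -> S v -> u <> y -> v <> y -> adj u v ->
  branch_root u = branch_root v.
Proof.
move=> Su Sv uy vy uv; have [Sz yz zu] := branch_rootP Su uy.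
by rewrite (branch_rootE (v := v) Sz yz) //; exact: reach_step zu uv _.
Qed.

End Root.
End Reach.

(** * Embedding into the universal trees *)

Section Embedding.
Variables (alpha : ordinal_number) (K : Type) (e : nat -> K) (G : graph) (iota : G -> K).
Hypothesis einj : injective e.
Hypothesis iotainj : injective iota.
Hypothesis Gacyclic : forall C, cycles C -> ~ immerses C G.
Hypothesis Grayless : rayless G.

(** A strong immersion of [induced S] into [utree e x] taking [y] to the root. It is a total map to
    plain lists, so that maps on branches can be combined without subtypes. *)
Definition rooted_embedding (S : set G) (y : G) (x : label alpha K)
    (f : G -> seq (label alpha K)) : Prop :=
  [/\ f y = [::], forall v, S v -> valid e x (f v),
      forall u v, S u -> S v -> f u = f v -> u = v &
      forall u v, S u -> S v -> adj u v <->
        (exists w, f v = rcons (f u) w) \/ exists w, f u = rcons (f v) w].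

(** The branch at [z] is placed below the child [l z] of the root by prefixing [l z] to [h z].
    Distinct branches are joined by no edge of [G], and their images are kept apart by the
    injectivity of [l]. *)
Lemma rooted_embedding_graft (S : set G) (y : G) (pc : piece S y)
    (x : label alpha K) (l : G -> label alpha K) (h : G -> G -> seq (label alpha K)) :
  (forall z, S z -> adj y z -> child e x (l z)) ->
  (forall z z', S z -> S z' -> adj y z -> adj y z' -> l z = l z' -> z = z') ->
  (forall z, S z -> adj y z -> rooted_embedding (branch S y z) z (l z) (h z)) ->
  exists f, rooted_embedding S y x f.
Proof.
move=> lx linj hemb; pose rho := branch_root pc.
have rhoP v : S v -> v <> y -> [/\ S (rho v), adj y (rho v) & branch S y (rho v) v].
  exact: branch_rootP.
pose f v := if pselect (v = y) then [::] else l (rho v) :: h (rho v) v.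
have fy : f y = [::] by rewrite /f; case: pselect.
have fN v : v <> y -> f v = l (rho v) :: h (rho v) v by rewrite /f; case: pselect.
(* In the branch containing [v], only its root is adjacent to [y], and only it is mapped by [h] to
   the empty list. *)
have froot v : S v -> v <> y -> adj y v <-> exists w, f v = rcons (f y) w.
  move=> Sv vy; have [Sz yz zv] := rhoP v Sv vy.
  have [hz _ hinj _] := hemb _ Sz yz.
  rewrite fy fN //; split=> [yv|[w [_ hv]]].
    have rv : rho v = v by apply: branch_rootE => //; exact: reach_refl.
    by exists (l (rho v)); rewrite /= -[X in h _ X]rv hz.
  by rewrite -(hinj (rho v) v) // ?hz ?hv //; exact: reach_refl.
have nroot v w : S v -> v <> y -> f y <> rcons (f v) w.
  by move=> Sv vy; rewrite fy; case: (f v).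
exists f; split=> //.
- move=> v Sv; have [->|vy] := pselect (v = y); first by rewrite fy.
  have [Sz yz zv] := rhoP v Sv vy; have [_ hval _ _] := hemb _ Sz yz.
  by rewrite fN //; split; [exact: lx|exact: hval].
- move=> u v Su Sv; have [->|uy] := pselect (u = y); have [->|vy] := pselect (v = y) => //.
  + by rewrite fy fN.
  + by rewrite fy fN.
  + rewrite !fN // => -[luv huv].
    have [Sz yz zu] := rhoP u Su uy; have [Sz' yz' zv] := rhoP v Sv vy.
    have ruv : rho u = rho v by exact: linj.
    have [_ _ hinj _] := hemb _ Sz yz.
    by apply: hinj => //; [rewrite ruv|rewrite huv ruv].
- move=> u v Su Sv; have [->|uy] := pselect (u = y); have [->|vy] := pselect (v = y).
  + split=> [/adj_irrefl //|]; rewrite fy.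
    by case=> -[].
  + rewrite froot //; split=> [|[//|[w /nroot]]]; first by left.
    by case.
  + have -> : adj u y <-> adj y u by split; exact: adj_sym.
    rewrite froot //; split=> [|[[w /nroot]|//]]; first by right.
    by case.
  + have [Sz yz zu] := rhoP u Su uy; have [Sz' yz' zv] := rhoP v Sv vy.
    have [_ _ _ hadj] := hemb _ Sz yz.
    rewrite !fN //; split=> [uv|uv].
      have ruv : rho u = rho v by exact: branch_root_adj.
      have zv' : branch S y (rho u) v by rewrite ruv.
      by case: ((hadj u v zu zv').1 uv) => -[w]; rewrite ruv => ->; [left|right]; exists w.
    have ruv : rho u = rho v by case: uv => -[w [luv _]]; [apply/esym|]; exact: linj.
    have zv' : branch S y (rho u) v by rewrite ruv.
    apply/hadj => //; case: uv => -[w [_ huv]]; [left|right]; exists w.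
      by rewrite -huv ruv.
    by rewrite huv ruv.
Qed.

(** Induction on [c], then on branches. The branches meeting a finite witness [F] are finitely many
    and are embedded with rank [c] by the inner induction; the others have smaller rank and fall
    under the outer one. *)
Lemma rooted_embedding_ex (c : alpha) (S : set G) (y : G) :
  piece S y -> rank_le c (induced S) ->
  exists m f, forall k, rooted_embedding S y (c, m, k) f.
Proof.
elim/(well_founded_ind (@ord_lt_wf alpha)): c S y => c IHc S y pc.
move: S y pc; apply: (piece_ind Grayless) => S y pc IHz Sc.
have [F [Ffin FP]] := rank_le_avoiding Sc.
pose nbr z := S z /\ adj y z.
pose Z0 := [set z | nbr z /\ exists2 u, F u & branch S y z (sval u)].
have Bsub z : nbr z -> branch S y z `<=` S by case=> Sz yz v /(branch_sub Sz yz)[].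
have nbrA z : nbr z -> (S `\ y) z.
  by case=> Sz yz; split=> // zy; move: yz; rewrite zy; exact: adj_irrefl.
have Z0fin : finite_set Z0.
  apply: (@sub_finite_set _ _ [set branch_root pc (sval u) | u in F]); last exact: finite_image.
  by move=> z [[Sz yz] [u Fu zu]]; exists u => //; exact: branch_rootE.
have dataex z : exists d : alpha * nat * (G -> seq (label alpha K)), nbr z ->
    (forall k, rooted_embedding (branch S y z) z (d.1.1, d.1.2, k) d.2) /\
    ((Z0 z /\ d.1.1 = c) \/ (~ Z0 z /\ ord_lt d.1.1 c)).
  have [nz|] := pselect (nbr z); last by exists (c, 0, fun=> [::]).
  have [Sz yz] := nz; have [Z0z|nZ0z] := pselect (Z0 z).
    have [m [f fP]] := IHz z Sz yz (sub_rank_le (Bsub z nz) Sc).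
    by exists (c, m, f) => _; split=> //; left.
  have [|||b bc Bb] := FP (induced (branch S y z))
    (fun u => exist _ (sval u) (Bsub z nz _ (svalP u))).
  - exact/reach_connected/nbrA.
  - by split=> // -[u ?] [v ?] /(congr1 sval) /= uv; exact: eq_exist.
  - move=> [u zu] Fu; apply: nZ0z; split=> //.
    by exists (exist _ u (Bsub z nz u (svalP (exist _ u zu)))); [exact: Fu|exact: zu].
  have [m [f fP]] := IHc b bc _ _ (@reach_piece _ _ _) Bb.
  by exists (b, m, f) => _; split=> //; right.
pose d z := sval (cid (dataex z)); have dP z := svalP (cid (dataex z)).
have [idx idxinj] := card_le_inP 0 (finite_set_countable Z0fin).
have [N NP] := finite_nat_ub (finite_image idx Z0fin).
have [M MP] := finite_nat_ub (finite_image (fun z => (d z).1.2) Z0fin).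
(* Branches in [Z0] have to use the finitely many copies [e i] available at rank [c]; the others
   have [K] copies at their disposal and are told apart by their roots. *)
pose l z : label alpha K := ((d z).1.1, (d z).1.2, if pselect (Z0 z) then e (idx z) else iota z).
(* [M] exceeds the parameters of the branches in [Z0], so passing to them lowers the second
   component; [N] exceeds their indices, so there are enough copies. *)
exists (maxn N M).
have [|||f fP] := @rooted_embedding_graft S y pc (c, maxn N M, e 0) l (fun z => (d z).2).
- move=> z Sz yz; have [_ [[Z0z dz]|[_ ?]]] := dP z (conj Sz yz); last by left.
  right; rewrite /l /=; split=> //.
    by rewrite leq_max orbC MP //; exists z.
  case: pselect => //= ?; exists (idx z) => //.
  by rewrite leq_max NP //; exists z.
- move=> z z' Sz Sz' yz yz' [].
  have [_ dz] := dP z (conj Sz yz); have [_ dz'] := dP z' (conj Sz' yz').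
  rewrite -/(d z) -/(d z') in dz dz' *.
  case: dz => -[Zz dz]; case: dz' => -[Zz' dz']; case: pselect => // ?; case: pselect => // ?.
  + by move=> _ _ /einj; exact: idxinj.
  + by move=> dd; move: dz'; rewrite -dd dz => /ord_ltxx.
  + by move=> dd; move: dz; rewrite dd dz' => /ord_ltxx.
  + by move=> _ _ /iotainj.
- by move=> z Sz yz; have [h _] := dP z (conj Sz yz); exact: h.
(* [child] ignores the third component of the parent label, so the arbitrary [e 0] can be replaced
   by any [k]. *)
exists f => k; case: fP => ? fval ? ?; split=> // v Sv.
by case: (f v) (fval v Sv).
Qed.

Lemma strongly_immerses_utree (c : alpha) : connected_graph G -> rank_le c G ->
  exists m, forall k, strongly_immerses G (utree e (c, m, k)).
Proof.
move=> [[y _] Gconn] Gc.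
have pc : piece [set: G] y.
  split=> // v _; apply: (linked_ind (P := reach setT y) (Gconn y v)); first exact: reach_refl.
  by move=> u w yu uw; exact: reach_step yu uw _.
have [|m [f fP]] := rooted_embedding_ex (c := c) pc.
  exact: rank_le_immersion (induced_immersion setT) Gc.
exists m => k; have [_ fval finj fadj] := fP k.
exists (fun v => exist _ (f v) (fval v Logic.I)); split.
  by move=> u v /(congr1 sval); exact: finj.
by move=> u v; exact: fadj.
Qed.

(** Induction on branches: once [y] is deleted, a strict upper bound of the ranks chosen for its
    branches bounds the rank of the whole. *)
Lemma rank_le_ex (a0 : alpha) :
  (forall g : G -> alpha, exists c, forall z, ord_lt (g z) c) ->
  connected_graph G -> exists c : alpha, rank_le c G.
Proof.
move=> sup [[y0 _] Gconn].
have pc0 : piece [set: G] y0.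
  split=> // v _; apply: (linked_ind (P := reach setT y0) (Gconn y0 v)); first exact: reach_refl.
  by move=> u w yu uw; exact: reach_step yu uw _.
suff [c cG] : exists c : alpha, rank_le c (induced [set: G]).
  exists c; apply: (rank_le_immersion (f := fun v => exist _ v Logic.I : induced [set: G])) cG.
  by split=> [u v []|].
move: [set: G] y0 pc0; apply: (piece_ind Grayless) => S y pc IHz.
have rex z : exists c : alpha, S z -> adj y z -> rank_le c (induced (branch S y z)).
  have [[Sz yz]|no] := pselect (S z /\ adj y z); last by exists a0 => Sz yz; case: no.
  by have [c ?] := IHz z Sz yz; exists c.
pose g z := sval (cid (rex z)).
have gP z : S z -> adj y z -> rank_le (g z) (induced (branch S y z)) := svalP (cid (rex z)).
have [c cP] := sup g; exists c; pose rho := branch_root pc.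
apply: (@rank_le_label _ _ (induced S) _ (exist _ y pc.1) (fun u => rho (sval u)) set0) => //.
- move=> [u Su] [v Sv] uy vy /= uv.
  apply: branch_root_adj => //; [move=> h; apply: uy|move=> h; apply: vy]; exact: eq_exist.
- move=> [v Sv] vy _; have {}vy : v <> y by move=> h; apply: vy; exact: eq_exist.
  have [Sz yz zv] := branch_rootP pc Sv vy; exists (g (rho v)) => //.
  set B := [set _ | _].
  have Br (u : induced B) : branch S y (rho v) (sval (sval u)).
    case: u => -[u Su] [uy /= <-].
    have {}uy : u <> y by move=> h; apply: uy; exact: eq_exist.
    by have [] := branch_rootP pc Su uy.
  apply: (rank_le_immersion (f := fun u : induced B =>
    exist _ _ (Br u) : induced (branch S y (rho v)))); last exact: gP.
  split=> // -[[u Su] Bu] [[w Sw] Bw] /(congr1 sval) /= uw.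
  by do 2! apply: eq_exist.
Qed.

End Embedding.

(** * Strong universality *)

Lemma least_card_le (P : Type -> Prop) (c : Type) :
  P c -> [set: least_card P] #<= [set: c].
Proof. by move=> Pc; have [_] := least_cardP (ex_intro _ c Pc); apply. Qed.

(** [Stc] is defined through injective families. Repetitions are removed by keeping one index [rep]
    for each value of [F]. *)
Lemma family_injective (D : graph_class) (c : Type) (F : c -> graph) :
  strongly_universal D (fun G => exists i, F i = G) ->
  exists c' : Type, [set: c'] #<= [set: c] /\
    exists F' : c' -> graph, injective F' /\
      strongly_universal D (fun G => exists i, F' i = G).
Proof.
move=> [FD Funiv]; pose rep (G : graph) (p : exists i, F i = G) := sval (cid p).
have repE G (p : exists i, F i = G) : F (rep G p) = G := svalP (cid p).
have rep_eq G G' p p' : G = G' -> rep G p = rep G' p'.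
  by move=> GG'; subst G'; rewrite (Prop_irrelevance p p').
have ex i : exists j, F j = F i by exists i.
exists {i | rep _ (ex i) = i}; split.
  by apply/card_leTP; exists sval => -[i ?] [j ?] /= ij; exact: eq_exist.
exists (fun u => F (sval u)); split.
  by move=> [i ri] [j rj] /= /(rep_eq _ _ (ex i) (ex j)) ij; apply: eq_exist; rewrite -ri -rj.
split=> [H [u uH]|G /Funiv[H [i iH] GH]]; first by apply: FD; exists (sval u).
exists H => //; have ri : rep _ (ex (rep _ (ex i))) = rep _ (ex i).
  by apply: rep_eq; exact: repE.
by exists (exist (fun j => rep _ (ex j) = j) _ ri) => /=; rewrite repE.
Qed.

Lemma Stc_card_le (D : graph_class) (c : Type) (F : c -> graph) :
  strongly_universal D (fun G => exists i, F i = G) -> [set: Stc D] #<= [set: c].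
Proof.
move=> /family_injective[c' [c'c F'P]].
by apply: card_le_trans c'c; exact: least_card_le.
Qed.

(** The given family only ensures that [Stc D] is not the junk value, so that the minimum is
    attained. *)
Lemma Stc_family (D : graph_class) (c : Type) (F : c -> graph) :
  strongly_universal D (fun G => exists i, F i = G) ->
  exists F' : Stc D -> graph, strongly_universal D (fun G => exists i, F' i = G).
Proof.
move=> /family_injective[c' [_ F'P]].
pose P c := exists F : c -> graph,
  injective F /\ strongly_universal D (fun G => exists i, F i = G).
by have [[F'' [_ F''P]] _] := @least_cardP P (ex_intro _ c' F'P); exists F''.
Qed.

(** * Successor cardinals and their initial ordinals *)

Lemma card_lt_succ_card (K : Type) : card_lt K (succ_card K).
Proof.
(* By Cantor's theorem some cardinal exceeds [K], so [succ_card K] is not the junk value. *)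
suff ltKset : card_lt K (set K) by have [] := least_cardP (ex_intro (card_lt K) _ ltKset).
split.
  apply/card_leTP; exists (fun x => [set x]) => x y xy.
  by suff : [set y] x by []; rewrite -xy.
move=> /card_leTP[f finj]; pose A := [set x | exists2 B, f B = x & ~ B x].
have [AfA|nA] := pselect (A (f A)).
  by case: (AfA) => B /finj -> nAfA.
by apply: (nA); exists A.
Qed.

Lemma succ_card_le (K c : Type) : ~ ([set: c] #<= [set: K]) -> [set: succ_card K] #<= [set: c].
Proof.
by move=> cK; apply: least_card_le; split=> //; have [] := card_le_total K c.
Qed.

Section SegmentOrdinal.
Variables (alpha : ordinal_number) (a : alpha).

Definition segment_le : rel {b | ord_lt b a} := fun u v => ord_le (sval u) (sval v).

Lemma segment_wo : well_order segment_le.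
Proof.
move=> A [u Au].
have [|b [[bu Ab] bmin]] := @ord_minimum alpha (fun b => exists p : ord_lt b a, exist _ b p \in A).
  by case: u Au => b p; exists b, p.
exists (exist _ b bu); split.
  by split=> // -[c cu] Ac; apply: bmin; exists cu.
move=> [c cu] [Ac cmin]; apply: eq_exist; apply: ord_le_anti; last exact: (cmin _ Ab).
by apply: bmin; exists cu.
Qed.

Definition segment_ordinal : ordinal_number := OrdinalNumber segment_wo.

End SegmentOrdinal.

(** Well-order [succ_card K]. If some proper initial segment has more than [K] elements, the first
    such segment serves as [W]. *)
Lemma succ_card_ordinal (K : Type) : exists W : ordinal_number,
  [/\ [set: W] #<= [set: succ_card K], ~ ([set: W] #<= [set: K]) &
      forall a : W, [set b | ord_lt b a] #<= [set: K]].
Proof.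
have [R Rwo] := well_ordering_principle {classic (succ_card K)}.
pose V : ordinal_number := @OrdinalNumber (succ_card K) R Rwo.
have [seg|/existsNP[a0 na0]] := pselect (forall a : V, [set b | ord_lt b a] #<= [set: K]).
  by exists V; split=> //; case: (card_lt_succ_card K).
have [|a [na amin]] := @ord_minimum V (fun a => ~ ([set b | ord_lt b a] #<= [set: K])).
  by exists a0.
exists (segment_ordinal a); split.
- by apply/card_leTP; exists sval => -[b ?] [c ?] /= bc; exact: eq_exist.
- by rewrite -(card_le_eql (card_le_sig _)).
- move=> [b ba]; have : [set c | ord_lt c b] #<= [set: K].
    by apply: contrapT => /amin /ord_leNgt.
  move=> /card_le_sigP[f finj]; apply/card_le_sigP.
  exists (fun u => f (exist (fun c => ord_lt c b) (sval (sval u)) (svalP u))).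
  move=> [[c ca] cb] [[d da] db] /finj/(congr1 sval) /= cd.
  by do 2! apply: eq_exist.
Qed.

(** * The values of [Stc] *)

Section Main.
Variables (K : Type) (e : nat -> K).
Hypothesis Kinf : infinite_set [set: K].
Hypothesis einj : injective e.

Lemma immerses_utree (alpha : ordinal_number) (c : alpha) (G : graph) :
  kappa_rayless_avoiding K cycles G -> rank_le c G ->
  exists m, forall k, strongly_immerses G (utree e (c, m, k)).
Proof.
move=> [[Gconn Gray /card_leTP[iota iotainj]] Gacyc] Gc.
exact: (strongly_immerses_utree einj iotainj).
Qed.

(** Whatever [n] is needed to embed [G] at rank [b], the tree [utree (b, n, k)] is a branch of
    [utree (c, m, k)]. *)
Lemma immerses_utree_lt (alpha : ordinal_number) (b c : alpha) (G : graph) m k :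
  kappa_rayless_avoiding K cycles G -> rank_le b G -> ord_lt b c ->
  strongly_immerses G (utree e (c, m, k)).
Proof.
move=> GA Gb bc; have [n] := immerses_utree GA Gb; move=> /(_ k)[f fimm].
have cb : child e (c, m, k) (b, n, k) by left.
by exists (subtree cb \o f); exact: strong_immersion_comp (subtree_strong_immersion cb).
Qed.

Lemma utree_immersed_rank (alpha : ordinal_number) (c d : alpha) (G : graph) m k :
  strongly_immerses (utree e (c, m, k)) G -> rank_le d G -> ord_le c d.
Proof.
move=> [f /strong_immersionW fimm] Gd.
exact: (rank_le_utree_ord_le Kinf (rank_le_immersion fimm Gd)).
Qed.

Section RankLt.
Variable alpha : ordinal_number.
Hypothesis segK : forall a : alpha, [set b | ord_lt b a] #<= [set: K].

Let D := kappa_rayless_avoiding_rank_lt K alpha cycles.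

Lemma utree_rank_lt (x : label alpha K) : D (utree e x).
Proof.
have [xA [b _ bx]] := utree_class Kinf einj segK x.
by split=> //; exists b.
Qed.

Lemma rank_lt_rank_le (G : graph) : D G -> exists a : alpha, rank_le a G.
Proof. by move=> [_ [a aG]]; exists a, a => //; exact: ord_lexx. Qed.

Lemma Stc_successor : is_successor_ord alpha -> [set: Stc D] #= [set: nat].
Proof.
move=> [mu muP]; have Dmu G : D G -> rank_le mu G.
  by move=> /rank_lt_rank_le[a]; exact: rank_le_ord_le.
have univ : strongly_universal D (fun G => exists m, utree e (mu, m, e 0) = G).
  split=> [H [m <-]|G DG]; first exact: utree_rank_lt.
  have [m mG] := immerses_utree DG.1 (Dmu G DG).
  by exists (utree e (mu, m, e 0)) => //; exists m.
apply/card_eqPle; split; first exact: Stc_card_le univ.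
apply/infiniteP => Stcfin; have [F [FD Funiv]] := Stc_family univ.
have bnd i : exists n, forall m k, immerses (utree e (mu, m, k)) (F i) -> m <= n.
  by apply: (rank_le_utree_bound Kinf einj); apply: Dmu; apply: FD; exists i.
pose n i := sval (cid (bnd i)).
have nP i : forall m k, immerses (utree e (mu, m, k)) (F i) -> m <= n i := svalP (cid (bnd i)).
have [N NP] := finite_nat_ub (finite_image n Stcfin).
(* [N] exceeds the bounds [n i] of all members of a finite family, so none of them can contain this
   tree. *)
have [_ [i <-] [f /strong_immersionW fimm]] := Funiv _ (utree_rank_lt (mu, N, e 0)).
have : N <= n i by apply: (nP i N (e 0)); exists f.
by rewrite leqNgt NP //; exists i.
Qed.

Lemma Stc_limit : ~ is_successor_ord alpha -> [set: Stc D] #= [set: cf alpha].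
Proof.
move=> nsucc; have above (a : alpha) : exists b, ord_lt a b.
  apply: contrapT => /forallNP no; apply: nsucc; exists a => b.
  by apply/ord_leNgt; exact: no.
pose P c := exists B : set alpha, cofinal B /\ (B #= [set: c]).
have [[B [Bcof Bcf]] _] : is_least_card P (cf alpha).
  apply: least_cardP; exists alpha, setT; split; last exact: card_eqxx.
  by move=> a; exists a => //; exact: ord_lexx.
have univ : strongly_universal D
    (fun G => exists u : {b | B b}, utree e (sval u, 0, e 0) = G).
  split=> [H [u <-]|G DG]; first exact: utree_rank_lt.
  (* Cofinality gives only [ord_le a' b]; the intermediate [a'] makes [b] strictly larger than
     [a]. *)
  have [a Ga] := rank_lt_rank_le DG; have [a' aa'] := above a.
  have [b Bb a'b] := Bcof a'; exists (utree e (b, 0, e 0)); first by exists (exist _ b Bb).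
  by apply: (immerses_utree_lt _ _ DG.1 Ga); exact: ord_lt_le_trans aa' a'b.
apply/card_eqPle; split.
  apply: card_le_trans (Stc_card_le univ) _.
  by rewrite -(card_le_eql (card_le_sig B)); have /card_eqPle[] := Bcf.
have [F [FD Funiv]] := Stc_family univ.
have rex i : exists a : alpha, rank_le a (F i).
  by apply: rank_lt_rank_le; apply: FD; exists i.
pose g i := sval (cid (rex i)); have gP i : rank_le (g i) (F i) := svalP (cid (rex i)).
(* The bounds [g i] form a cofinal set, since a member containing [utree (a, 0, e 0)] has [g i] at
   least [a]. *)
apply: card_le_trans (card_image_le g setT).
rewrite (card_le_eqr (card_le_sig _)); apply: least_card_le.
exists (range g); split; last exact: card_le_sig.
move=> a; have [_ [i <-] aF] := Funiv _ (utree_rank_lt (a, 0, e 0)).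
by exists (g i); [exists i|exact: utree_immersed_rank aF (gP i)].
Qed.

End RankLt.

Lemma Stc_all : [set: Stc (kappa_rayless_avoiding K cycles)] #= [set: succ_card K].
Proof.
set D := kappa_rayless_avoiding K cycles.
have [W [Wle WK segK]] := succ_card_ordinal K.
(* Regularity: if the family were unbounded, at most [K] closed initial segments, each with at most
   [K] elements, would cover [W]. *)
have sup (I : Type) (g : I -> W) : [set: I] #<= [set: K] -> exists c, forall i, ord_lt (g i) c.
  move=> IK; apply: contrapT => /forallNP no; apply: WK.
  apply: (cover_card_le Kinf (A := fun i => [set c | ord_le c (g i)]) IK) => [i|c].
    by apply: (setU1_card_le Kinf (t := g i) (segK (g i))) => b /ord_le_eqVlt[].
  have /existsNP[i /ord_leNgt gi] := no c; by exists i.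
have [w0 _] : exists w : W, True.
  apply: contrapT => no; apply: WK; apply/card_leTP.
  by exists (fun=> e 0) => x; case: no; exists x.
have rankW G : D G -> exists c : W, rank_le c G.
  move=> [[Gconn Gray GK] Gacyc]; apply: (rank_le_ex Gacyc Gray w0) => //.
  by move=> g; exact: sup.
have univ : strongly_universal D (fun G => exists c : W, utree e (c, 0, e 0) = G).
  split=> [H [c <-]|G DG]; first by case: (utree_class Kinf einj segK (c, 0, e 0)).
  have [b Gb] := rankW G DG.
  have [|c bc] := sup unit (fun=> b).
    by apply/card_leTP; exists (fun=> e 0) => -[] [].
  by exists (utree e (c, 0, e 0)); [exists c|exact: immerses_utree_lt DG Gb (bc tt)].
apply/card_eqPle; split; first exact: card_le_trans (Stc_card_le univ) Wle.
apply: succ_card_le => StcK; have [F [FD Funiv]] := Stc_family univ.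
have rex i : exists c : W, rank_le c (F i) by apply: rankW; apply: FD; exists i.
pose g i := sval (cid (rex i)); have gP i : rank_le (g i) (F i) := svalP (cid (rex i)).
(* If at most [K] members sufficed, [c] would lie above all their ranks, and [utree (c, 0, e 0)]
   would immerse into none of them. *)
have [c cP] := sup _ g StcK.
have [_ [i <-] cF] := Funiv _ (utree_class Kinf einj segK (c, 0, e 0)).1.
by have /ord_leNgt := utree_immersed_rank cF (gP i); apply.
Qed.

End Main.

Theorem theorem7p2 (K : Type) (K_infinite : infinite_set [set: K]) :
  (forall alpha : ordinal_number,
     is_nonzero_ord alpha -> card_lt alpha (succ_card K) ->
     (is_successor_ord alpha ->
        [set: Stc (kappa_rayless_avoiding_rank_lt K alpha cycles)]
          #= [set: nat]) /\
     (is_limit_ord alpha ->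
        [set: Stc (kappa_rayless_avoiding_rank_lt K alpha cycles)]
          #= [set: cf alpha])) /\
  ([set: Stc (kappa_rayless_avoiding K cycles)] #= [set: succ_card K]).
Proof.
have [e einj] := infinite_inj_nat K_infinite.
split=> [alpha _ [_ alphaK]|]; last exact: Stc_all einj.
(* An ordinal below [succ_card K] has at most [K] elements, because any larger cardinal is at least
   [succ_card K]. *)
have segK (a : alpha) : [set b | ord_lt b a] #<= [set: K].
  apply: card_le_trans (card_leT _) _; apply: contrapT => nK.
  exact/alphaK/succ_card_le.
by split=> [|[_]]; [exact: (Stc_successor _ einj)|exact: (Stc_limit _ einj)].
Qed.
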